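(* For any $m_1\neq m_2\in\Gamma_N$ and any $s>0$, there exist absolute constants $k_1,k_2>0$ such that $$\mathbb{P}_J\left(\frac{Z_{\beta,N}\,\mathrm{cap}(\mathcal{S}_N[m_1],\mathcal{S}_N[m_2])}{\tilde Z_{\beta,N}\,\mathrm{cap}^{\mathrm{CW}}(\mathcal{S}_N[m_1],\mathcal{S}_N[m_2])}\le\mathrm{e}^{s+2\beta(1+h)+\alpha}(1+o(1))\right)\ge1-k_1\mathrm{e}^{-k_2s^2},$$ asymptotically as $N\to\infty$, where $\alpha=\frac{\beta^2(1-p)}{4p}$.
   Context: $p\in(0,1)$ is fixed, $\beta\in(0,\infty)$ is the inverse temperature and $h>0$ is a constant external magnetic field. $\mathcal{S}_N=\{-1,+1\}^N$; $(J_{ij})_{1\le i<j\le N}$ are i.i.d. Bernoulli($p$), $J_{ji}=J_{ij}$, with joint law $\mathbb{P}_J$. The randomly dilute Curie--Weiss Hamiltonian is $H_N(\sigma)=-\frac1{Np}\sum_{i<j}J_{ij}\sigma_i\sigma_j-h\sum_i\sigma_i$; the Curie--Weiss (CW) Hamiltonian is $\tilde H_N(\sigma)=-\frac1N\sum_{i<j}\sigma_i\sigma_j-h\sum_i\sigma_i$ (the $J$-mean of $H_N$). Gibbs measures: $\mu_{\beta,N}(\sigma)=\mathrm{e}^{-\beta H_N(\sigma)}/Z_{\beta,N}$, $Z_{\beta,N}=\sum_\sigma\mathrm{e}^{-\beta H_N(\sigma)}$; $\tilde\mu_{\beta,N}(\sigma)=\mathrm{e}^{-\beta\tilde H_N(\sigma)}/\tilde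 Z_{\beta,N}$, $\tilde Z_{\beta,N}=\sum_\sigma\mathrm{e}^{-\beta\tilde H_N(\sigma)}$. Given $J$, the Metropolis chain on $\mathcal{S}_N$ has transition probabilities $p_N(\sigma,\sigma')=\frac1N\exp(-\beta[H_N(\sigma')-H_N(\sigma)]_+)$ if $\sigma,\sigma'$ differ in exactly one spin, $p_N(\sigma,\sigma)=1-\sum_{\eta\neq\sigma}p_N(\sigma,\eta)$, and $0$ otherwise, where $[x]_+=\max(x,0)$; $\mathbb{P}_\sigma$ is its (quenched) law started at $\sigma$. The CW chain is defined identically with $\tilde H_N$ in place of $H_N$. Hitting times: $\tau_A=\inf\{t>0:\sigma(t)\in A\}$. For disjoint $A,B\subset\mathcal{S}_N$ the capacity is $\mathrm{cap}(A,B)=\sum_{\sigma\in A}\mu_{\beta,N}(\sigma)\mathbb{P}_\sigma(\tau_B<\tau_A)$, and $\mathrm{cap}^{\mathrm{CW}}(A,B)$ is the same quantity for the CW chain and $\tilde\mu_{\beta,N}$. $m(\sigma)=\frac1N\sum_i\sigma_i\in\Gamma_N=\{-1,-1+\frac2N,\dots,1\}$ and $\mathcal{S}_N[m]=\{\sigma\in\mathcal{S}_N:m(\sigma)=m\}$. *)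

(* Defs.v *)
From HB Require Import structures.
From mathcomp Require Import all_boot all_order all_algebra.
From mathcomp Require Import all_classical all_reals all_analysis.
From mathcomp Require Import ring lra.

Set Implicit Arguments.
Unset Strict Implicit.
Unset Printing Implicit Defensive.

Import Order.TTheory GRing.Theory Num.Theory.
Import numFieldNormedType.Exports.

Local Open Scope classical_set_scope.
Local Open Scope ring_scope.

(* Spin configurations {-1,+1}^N are boolean tuples, true standing for +1. *)
Definition config (N : nat) : Type := N.-tuple bool.
HB.instance Definition _ N := Finite.on (config N).
HB.instance Definition _ N := isPointed.Build (config N) (nseq_tuple N false).

(* Unordered pairs {i,j} of sites, represented by i < j. *)
Definition edge (N : nat) : Type := {e : 'I_N * 'I_N | (e.1 < e.2)%N}.
HB.instance Definition _ N := Finite.on (edge N).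

(* A realisation of the couplings (J_ij)_{i<j}, with J_ij in {0,1}. *)
Definition disorder (N : nat) : Type := {ffun edge N -> bool}.
HB.instance Definition _ N := Finite.on (disorder N).

Section chain_law.
Context {R : realType}.
Variable N : nat.
Implicit Types (q : config N -> config N -> R) (s : config N).

Definition stochastic q : Prop :=
  (forall x y, 0 <= q x y) /\ (forall x, \sum_y q x y = 1).

Definition coord_sets : set (set (nat -> config N)) :=
  [set A | exists n x, A = [set w | w n = x]].

(* Trajectories (w t)_{t >= 0} with the product sigma-algebra. *)
Definition pathspace := g_sigma_algebraType coord_sets.

Definition cylinder (n : nat) (x : nat -> config N) : set pathspace :=
  [set w | forall k, (k <= n)%N -> w k = x k].

Definition is_chain_law q s (P : probability pathspace R) : Prop :=
  forall n x,
    P (cylinder n x) = ((x 0%N == s)%:R * \prod_(k < n) q (x k) (x k.+1))%:E.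

(* The law of the Markov chain with transition matrix q started at s.  It
   exists as soon as q is stochastic (chain_lawP); cylinders are stable under
   intersection up to the empty set, so they determine it. *)
Definition chain_law q s : probability pathspace R :=
  get [set P | is_chain_law q s P].

End chain_law.

Section model.
Context {R : realType}.
Variable N : nat.
Implicit Types (s t : config N) (J : disorder N) (H : config N -> R).

Definition spin s (i : 'I_N) : R := if tnth s i then 1 else -1.

Definition magnetization s : R := N%:R^-1 * \sum_i spin s i.

Definition Gamma : set R :=
  [set m | exists2 k : nat, (k <= N)%N & m = -1 + 2 * k%:R / N%:R].

Definition level (m : R) : {set config N} := [set s | magnetization s == m]%SET.

Definition rdcw_energy (p h : R) J s : R :=
  - ((N%:R * p)^-1 *
     \sum_(e : edge N) (J e)%:R * spin s (val e).1 * spin s (val e).2)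
  - h * \sum_i spin s i.

Definition cw_energy (h : R) s : R :=
  - (N%:R^-1 * \sum_(e : edge N) spin s (val e).1 * spin s (val e).2)
  - h * \sum_i spin s i.

(* P_J, the product Bernoulli(p) law of the couplings (J_ij)_{i<j}. *)
Definition prob_J (p : R) (E : pred (disorder N)) : R :=
  \sum_(J : disorder N | E J) \prod_(e : edge N) bernoulli_pmf p (J e).

Definition partition_function (beta : R) H : R := \sum_s expR (- beta * H s).

Definition gibbs (beta : R) H s : R :=
  expR (- beta * H s) / partition_function beta H.

Definition one_flip s t : bool := #|[set i | tnth s i != tnth t i]%SET| == 1%N.

Definition flip_rate (beta : R) H s t : R :=
  if one_flip s t then N%:R^-1 * expR (- beta * Num.max (H t - H s) 0) else 0.

Definition metropolis (beta : R) H s t : R :=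
  if t == s then 1 - \sum_(u | u != s) flip_rate beta H s u
  else flip_rate beta H s t.

(* tau_A = inf {t > 0 : w t \in A}, equal to +oo when the set is empty. *)
Definition hitting_time (A : {set config N}) (w : nat -> config N) : \bar R :=
  ereal_inf [set t%:R%:E | t in [set t : nat | (0 < t)%N /\ w t \in A]].

Definition capacity (beta : R) H (A B : {set config N}) : R :=
  \sum_(s in A) gibbs beta H s *
    fine (chain_law (metropolis beta H) s
            [set w | (hitting_time B w < hitting_time A w)%E]).

Lemma metropolis_stochastic (beta : R) H : 0 <= beta ->
  stochastic (metropolis beta H).
Proof.
move=> b0; split=> [s t|s]; last first.
  rewrite (bigD1 s)//= {1}/metropolis eqxx.
  under eq_bigr => t ts do rewrite /metropolis (negbTE ts).
  by rewrite subrK.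
have rate0 u v : 0 <= flip_rate beta H u v.
  by rewrite /flip_rate; case: ifP => // _; rewrite mulr_ge0 ?expR_ge0// invr_ge0.
rewrite /metropolis; case: ifP => // _; rewrite subr_ge0.
pose flip (i : 'I_N) : config N :=
  [tuple if j == i then ~~ tnth s j else tnth s j | j < N].
have rate1 i : flip_rate beta H s (flip i) <= N%:R^-1.
  rewrite /flip_rate; case: ifP => _; last by rewrite invr_ge0.
  rewrite ler_piMr ?invr_ge0// -expR0 ler_expR mulNr oppr_le0 mulr_ge0//.
  by rewrite le_max lexx orbT.
have le1 : \sum_(i < N) flip_rate beta H s (flip i) <= 1.
  apply: (@le_trans _ _ (\sum_(i < N) N%:R^-1)); first exact: ler_sum.
  rewrite sumr_const card_ord -[leLHS]mulr_natr.
  have [->|n0] := eqVneq (N%:R : R) 0; first by rewrite mulr0.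
  by rewrite mulVf.
apply: le_trans le1.
have supp u : flip_rate beta H s u != 0 -> exists i, u = flip i.
  rewrite /flip_rate; case: ifP => [/cards1P[i hi] _|]; last by rewrite eqxx.
  exists i; apply: eq_from_tnth => j; rewrite tnth_mktuple.
  have := congr1 (fun A : {set 'I_N} => j \in A) hi.
  rewrite finset.in_set finset.in_set1.
  case: (j == i) => [|/negbFE/eqP//].
  by case: (tnth s j) (tnth u j) => [] [].
have flip_inj : injective flip.
  move=> i j ij; apply/eqP; have := congr1 (fun u => tnth u i) ij.
  by rewrite !tnth_mktuple eqxx; case: (i == j) => //; case: (tnth s i).
rewrite [leRHS](_ : _ = \sum_(u in [set flip i | i in 'I_N]%SET) flip_rate beta H s u).
  rewrite [leLHS](bigID (fun u => u \in [set flip i | i in 'I_N]%SET))/=.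
  rewrite [X in _ + X]big1 ?addr0; last first.
    move=> u /andP[_ uf]; apply/eqP; apply: contraNT uf => /supp[i ->].
    exact: imset_f.
  rewrite [leRHS](bigID (fun u => u != s))/=.
  rewrite (eq_bigl (fun u => (u \in [set flip i | i in 'I_N]%SET) && (u != s))).
    by rewrite lerDl sumr_ge0.
  by move=> u; rewrite andbC.
by rewrite big_imset//= => ? ? _ _ /flip_inj.
Qed.

End model.
Arguments Gamma {R} N.

(* Existence of the law of a chain: a uniform u in [0,1[ selects the next state
   y through the subdivision of [0,1[ into intervals of lengths q x y, and its
   rescaled position in that interval is used for the following step. *)
Section chain_law_exists.
Context {R : realType}.
Variables (N : nat) (q : config N -> config N -> R).
Hypothesis qs : stochastic q.
Implicit Types (x y s : config N) (u : R).

Let q0 x y : 0 <= q x y. Proof. exact: qs.1. Qed.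
Let q1 x : \sum_y q x y = 1. Proof. exact: qs.2. Qed.

Let cum x y : R := \sum_(z | (enum_rank z < enum_rank y)%N) q x z.

Let cum0 x y : 0 <= cum x y. Proof. by apply: sumr_ge0. Qed.

Let cum_le x y z : (enum_rank y < enum_rank z)%N -> cum x y + q x y <= cum x z.
Proof.
move=> yz; rewrite /cum [leRHS](bigD1 y)//= [leLHS]addrC lerD2l.
rewrite [leRHS](bigID (fun t => (enum_rank t < enum_rank y)%N))/=.
rewrite -[leLHS]addr0 lerD ?sumr_ge0//.
rewrite le_eqVlt; apply/orP; left; apply/eqP/eq_bigl => t.
apply/idP/idP => [ty|/andP[]//].
rewrite ty (ltn_trans ty yz) andbT/=; apply/eqP => ty'.
by rewrite ty' ltnn in ty.
Qed.

Let cum1 x y : cum x y + q x y <= 1.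
Proof.
rewrite -(q1 x) (bigD1 y)//= [leLHS]addrC lerD2l /cum.
rewrite [leRHS](bigID (fun t => (enum_rank t < enum_rank y)%N))/=.
rewrite -[leLHS]addr0 lerD ?sumr_ge0//.
rewrite le_eqVlt; apply/orP; left; apply/eqP/eq_bigl => t.
apply/idP/idP => [ty|/andP[]//].
by rewrite ty andbT; apply/eqP => ty'; rewrite ty' ltnn in ty.
Qed.

Let sel x u y := (cum x y <= u) && (u < cum x y + q x y).

Let sel_uniq x u y z : sel x u y -> sel x u z -> y = z.
Proof.
move=> /andP[y1 y2] /andP[z1 z2]; apply: enum_rank_inj; apply: val_inj => /=.
case: (ltngtP (enum_rank y) (enum_rank z)) => // yz.
- by have := lt_le_trans y2 (le_trans (cum_le x yz) z1); rewrite ltxx.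
- by have := lt_le_trans z2 (le_trans (cum_le x yz) y1); rewrite ltxx.
Qed.

Let sel_ex x u : 0 <= u < 1 -> exists y, sel x u y.
Proof.
move=> /andP[u0 u1].
pose P k := [exists y, (enum_rank y == k :> nat) && (cum x y <= u)].
have exP : exists k, P k.
  have c0 : (0 < #|{: config N}|)%N by apply/card_gt0P; exists x.
  exists 0%N; apply/existsP; exists (enum_val (Ordinal c0)).
  rewrite enum_valK/= /cum big1// => z; by rewrite enum_valK.
have ubP k : P k -> (k <= #|{: config N}|)%N.
  by move=> /existsP[y /andP[/eqP <- _]]; exact: ltnW.
case: (ex_maxnP exP ubP) => k /existsP[y /andP[/eqP yk yu]] kmax.
exists y; rewrite /sel yu/= ltNge; apply/negP => hu.
have [kc|kc] := ltnP k.+1 #|{: config N}|.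
  pose z : config N := enum_val (Ordinal kc).
  have : P k.+1.
    apply/existsP; exists z; rewrite enum_valK eqxx/=.
    apply: le_trans hu; rewrite /cum (bigD1 y)/=; last by rewrite enum_valK yk.
    rewrite addrC lerD2r le_eqVlt; apply/orP; left; apply/eqP/eq_bigl => t.
    rewrite enum_valK/= ltnS leq_eqVlt yk andb_orl; case: eqP => [tk|tk]/=.
      have -> : t = y by apply: enum_rank_inj; apply: val_inj; rewrite /= tk.
      by rewrite eqxx/= yk ltnn.
    by case: eqP => [ty|_]; rewrite ?andbT// ty yk in tk *.
  by move=> /kmax; rewrite ltnn.
suff : 1 <= cum x y + q x y by move=> /le_trans/(_ hu); rewrite leNgt u1.
rewrite -(q1 x) (bigD1 y)//= addrC lerD2r le_eqVlt; apply/orP; left.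
apply/eqP/eq_bigl => t; rewrite yk.
have tk : (enum_rank t <= k)%N by rewrite -ltnS (leq_trans (ltn_ord _) kc).
rewrite ltn_neqAle tk andbT; apply/idP/idP; apply: contra.
  by move=> /eqP tk'; apply/eqP; apply: enum_rank_inj; apply: val_inj; rewrite /= tk' yk.
by move=> /eqP ->; rewrite yk.
Qed.

Let nxt x u : config N := odflt x [pick y | sel x u y].

Let nxtP x u y : 0 <= u < 1 -> (nxt x u = y) <-> sel x u y.
Proof.
move=> u01; rewrite /nxt; case: pickP => [z zu|no]/=; last first.
  by have [z] := sel_ex x u01; rewrite no.
by split=> [<-//|yu]; exact: sel_uniq zu yu.
Qed.

Let step (xu : config N * R) : config N * R :=
  let y := nxt xu.1 xu.2 in (y, (xu.2 - cum xu.1 y) / q xu.1 y).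

Let traj s u : pathspace N :=
  fun t => if 0 <= u < 1 then (iter t step (s, u)).1 else s.

Let Fixpoint left_end x (l : seq (config N)) : R :=
  if l is y :: l' then cum x y + q x y * left_end y l' else 0.
Let Fixpoint width x (l : seq (config N)) : R :=
  if l is y :: l' then q x y * width y l' else 1.
Let Fixpoint follows x u (l : seq (config N)) : Prop :=
  if l is y :: l' then
    nxt x u = y /\ follows y ((u - cum x y) / q x y) l' else True.

Let width0 x l : 0 <= width x l.
Proof. by elim: l x => //= y l IH x; rewrite mulr_ge0. Qed.
Let left0 x l : 0 <= left_end x l.
Proof. by elim: l x => //= y l IH x; rewrite addr_ge0 ?mulr_ge0. Qed.
Let right1 x l : left_end x l + width x l <= 1.
Proof.
elim: l x => /= [x|y l IH x]; first by rewrite add0r.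
rewrite -addrA -mulrDr; apply: le_trans (cum1 x y).
by rewrite lerD2l ler_piMr.
Qed.

Let followsP x l u :
  (0 <= u < 1 /\ follows x u l) <->
  left_end x l <= u < left_end x l + width x l.
Proof.
elim: l x u => /= [x u|y l IH x u]; first by rewrite add0r; split=> [[]|].
have c0 := cum0 x y; have c1 := cum1 x y.
split=> [[u01 [/(nxtP _ _ u01)/andP[h1 h2] fl]]|/andP[h1 h2]].
  have qp : 0 < q x y by lra.
  have r01 : 0 <= (u - cum x y) / q x y < 1.
    by rewrite ler_pdivlMr// ltr_pdivrMr//; apply/andP; split; lra.
  have [/(_ (conj r01 fl)) + _] := IH y ((u - cum x y) / q x y).
  rewrite ler_pdivlMr// ltr_pdivrMr// mulrDl !(mulrC _ (q x y)) => /andP[? ?].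
  by apply/andP; split; lra.
have qw : 0 < q x y * width y l by lra.
have qp : 0 < q x y.
  by rewrite lt_neqAle q0 andbT eq_sym; apply/eqP => qe; rewrite qe mul0r ltxx in qw.
have ql : 0 <= q x y * left_end y l by rewrite mulr_ge0.
have qr : q x y * left_end y l + q x y * width y l <= q x y.
  by rewrite -mulrDr ler_piMr.
have u01 : 0 <= u < 1 by apply/andP; split; lra.
have [_] := IH y ((u - cum x y) / q x y).
rewrite ler_pdivlMr// ltr_pdivrMr// mulrDl !(mulrC _ (q x y)) => IH'.
have [_ fl] : 0 <= (u - cum x y) / q x y < 1 /\ follows y ((u - cum x y) / q x y) l.
  by apply: IH'; apply/andP; split; lra.
by split=> //; split=> //; apply/(nxtP _ _ u01)/andP; split; lra.
Qed.

Let prefix_l (n : nat) (w : nat -> config N) := [seq w k | k <- iota 1 n].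

Let iter_follows n s u (w : nat -> config N) :
  follows s u (prefix_l n w) <->
  (forall k, (0 < k <= n)%N -> (iter k step (s, u)).1 = w k).
Proof.
elim: n s u w => [s u w|n IH s u w].
  by split=> // _ [|k].
have -> : prefix_l n.+1 w = w 1%N :: prefix_l n (fun k => w k.+1).
  rewrite /prefix_l/=; congr cons.
  by rewrite (iotaDl 1 1 n) -map_comp.
have E : nxt s u = w 1%N ->
    step (s, u) = (w 1%N, (u - cum s (w 1%N)) / q s (w 1%N)).
  by move=> h1; rewrite /step/= h1.
rewrite /= IH; split=> [[h1 h2] [|[|k]]|h].
- by [].
- by [].
- by move=> kn; rewrite iterSr E// h2.
- have h1 : nxt s u = w 1%N by exact: h 1%N isT.
  by split=> // k /andP[k0 kn]; rewrite -(h k.+1)// iterSr E.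
Qed.

Let traj_cyl n s (w : nat -> config N) : w 0%N = s ->
  `[0, 1[%classic `&` (traj s @^-1` cylinder n w) =
  `[left_end s (prefix_l n w),
    left_end s (prefix_l n w) + width s (prefix_l n w)[%classic.
Proof.
move=> w0; apply/seteqP; split => u /=; rewrite !in_itv/=.
  move=> [u01 tw]; apply/followsP; split=> //; apply/iter_follows => k /andP[k0 kn].
  by have := tw k kn; rewrite /traj u01.
move=> /followsP[u01 /iter_follows fl]; split=> // -[|k] kn.
  by rewrite /traj u01/= w0.
by have := fl k.+1 kn; rewrite /traj u01.
Qed.

Let measurable_traj s :
  measurable_fun [set: measurableTypeR R] (traj s : measurableTypeR R -> pathspace N).
Proof.
apply (@measurability _ _ (measurableTypeR R) (pathspace N) setT (traj s) (@coord_sets N)) => //.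
move=> _ [_ [n [x ->]] <-]; rewrite setTI.
set A := traj s @^-1` _.
have mI : measurable (`[0, 1[%classic : set (measurableTypeR R)).
  exact: measurable_itv.
rewrite -(setIT A) -(setUv `[0, 1[%classic) setIUr.
apply: measurableU; last first.
  have [sx|sx] := eqVneq s x.
    suff -> : A `&` ~` `[0, 1[%classic = ~` `[0, 1[%classic by exact: measurableC.
    rewrite setIidr// => u; rewrite /A/= in_itv/= => /negP u01.
    by rewrite /traj (negbTE u01).
  suff -> : A `&` ~` `[0, 1[%classic = set0 by exact: measurable0.
  apply/seteqP; split => // u; rewrite /A/= in_itv/= => -[tx /negP u01].
  by move: tx; rewrite /traj (negbTE u01) => sx'; rewrite sx' eqxx in sx.
pose ext (f : {ffun 'I_n.+1 -> config N}) k := f (inord k).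
have -> : A `&` `[0, 1[%classic =
    \bigcup_(f in [set f : {ffun 'I_n.+1 -> config N} |
        ext f 0%N = s /\ ext f n = x])
      (`[0, 1[%classic `&` (traj s @^-1` cylinder n (ext f))).
  apply/seteqP; split => u.
    move=> [Au u01].
    exists [ffun k : 'I_n.+1 => traj s u k].
      rewrite /ext/= !ffunE !inordK//; split; last exact: Au.
      by rewrite /traj; case: ifP.
    by split=> // k kn; rewrite /ext ffunE inordK.
  move=> [f [f0 fn] [u01 cu]]; split=> //.
  by rewrite /A/= (cu n)//.
apply: fin_bigcup_measurable; first exact: finite_finset.
move=> f [f0 _]; rewrite (traj_cyl n f0); exact: measurable_itv.
Qed.

Let mI : measurable (`[0, 1[%classic : set (measurableTypeR R)).
Proof. exact: measurable_itv. Qed.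

Let unif := mrestr (@lebesgue_measure R) mI.
HB.instance Definition _ := Measure.on unif.

Let unif1 : unif setT = 1%E.
Proof.
rewrite /unif /mrestr setTI lebesgue_measure_itv/= lte_fin ltr01.
by rewrite -EFinB subr0.
Qed.

HB.instance Definition _ := Measure_isProbability.Build _ _ _ unif unif1.

HB.instance Definition _ s :=
  isMeasurableFun.Build _ _ _ _ (traj s : measurableTypeR R -> pathspace N)
    (measurable_traj s).

Let width_prefix n (x : nat -> config N) : width (x 0%N) (prefix_l n x) = \prod_(k < n) q (x k) (x k.+1).
Proof.
elim: n x => [|n IH] x; first by rewrite big_ord0.
rewrite big_ord_recl/= -(IH (fun k => x k.+1)); congr (_ * width _ _).
by rewrite /prefix_l (iotaDl 1 1 n) -map_comp.
Qed.

Lemma chain_law_exists s : exists P : probability (pathspace N) R, is_chain_law q s P.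
Proof.
exists (distribution unif (traj s : {mfun measurableTypeR R >-> pathspace N})) => n x.
transitivity (lebesgue_measure
    (`[0, 1[%classic `&` (traj s @^-1` cylinder n x))); first by rewrite setIC.
have [xs|xs] := eqVneq (x 0%N) s.
  rewrite traj_cyl// lebesgue_measure_itv/= mul1r -width_prefix xs.
  case: ifPn => [_|]; first by rewrite -EFinB addrAC subrr add0r.
  rewrite lte_fin -leNgt gerDl => w0; congr EFin.
  by apply/esym/eqP; rewrite eq_le w0 width0.
rewrite mul0r (_ : _ `&` _ = set0) ?measure0//.
apply/seteqP; split=> // u /= [u01 /(_ 0%N isT)]; rewrite /traj => e.
by move: xs; rewrite -e; case: ifP => /=; rewrite eqxx.
Qed.

Lemma chain_lawP s : is_chain_law q s (chain_law q s).
Proof.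
have [P hP] := chain_law_exists s.
by apply: (@getPex _ [set P | is_chain_law q s P]); exists P.
Qed.

End chain_law_exists.

(* Main.v *)
Require Import Defs.
From mathcomp Require Import all_boot all_order all_algebra.
From mathcomp Require Import all_classical all_reals all_analysis.
From mathcomp Require Import ring lra.

Set Implicit Arguments.
Unset Strict Implicit.
Unset Printing Implicit Defensive.

Import Order.TTheory GRing.Theory Num.Theory.
Import numFieldNormedType.Exports.

Local Open Scope classical_set_scope.
Local Open Scope ring_scope.

(** The proof compares two Dirichlet forms and then controls one exponential
moment of the couplings.

For a reversible chain, [Z * cap(A, B)] is the minimum of the Dirichlet form
over functions equal to 1 on A and 0 on B, attained at the equilibrium
potential h ([capacity_equilibrium], [capacity_le_dirichlet]).  Both facts come
from the identity [Z * cap = D(u, h)] for all admissible u, which is summation by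
parts combined with harmonicity of h off A and B; the latter is the one-step
equation [first_step] for the probability of visiting B before A.

Insert the Curie-Weiss equilibrium potential f as a test function for the
dilute model.  Since the conductance of a flip x - y is
[exp (- beta max (H x, H y)) / N], bounding the maximum below by [H x] costs
nothing for the upper bound on the dilute form, while bounding it above for the
Curie-Weiss form costs [exp (2 beta (1 + h))], because a flip changes the
Curie-Weiss energy by at most [2 (1 + h)].  With
[w x = exp (- beta H~ x) * |grad f|^2 x], which does not depend on the couplings,
the ratio of capacities is thus at most [exp (2 beta (1 + h))] times the
w-average of [X_x = exp (- beta (H x - H~ x))].

Each [X_x] is the exponential of a centred linear form in the independent
couplings, with at most N^2 coefficients equal to [+- beta / (N p)]; hence
[E X_x^k <= exp (C k^2)] with [C = 2 beta^2 / p^2], uniformly in x and N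
([disorder_mgf]).  If the w-average of X exceeds [e^s], then by convexity the
w-average of [(X e^-s)^k] is at least 1, so that Markov's inequality bounds the
probability by [exp (C k^2 - k s)] for every natural k
([prob_J_weighted_tail]).  Taking k close to [s / (2 C)] gives a Gaussian tail in
s ([exists_tail_exponent]); rounding k to an integer is paid for by the prefactor
[k1 = exp (C / 2)].  The moment bound holds for every N >= 1, so the error
term can be taken to be 0. *)

(** * Visiting B before A: the one-step equation *)

Section first_step.
Context {R : realType}.
Variables (N : nat) (q : config N -> config N -> R) (A B : {set config N}).
Hypothesis qs : stochastic q.
Implicit Types (x y s : config N).

Lemma measurable_coord (k : nat) (Q : set (config N)) :
  measurable ([set w | Q (w k)] : set (pathspace N)).
Proof.
rewrite (_ : [set w | _] = \bigcup_(y in Q) [set w : pathspace N | w k = y]).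
  apply: fin_bigcup_measurable; first exact: finite_finset.
  by move=> y _; apply: sub_sigma_algebra; exists k, y.
by apply/seteqP; split=> [w Qw|w [y Qy /= ->]//]; exists (w k).
Qed.

Lemma measurable_cylinder n (x : nat -> config N) : measurable (cylinder n x).
Proof.
rewrite (_ : cylinder n x = \bigcap_(k in [set k | (k <= n)%N])
    [set w : pathspace N | [set x k] (w k)]); last first.
  by apply/seteqP; split.
by apply: bigcap_measurableType => k _; exact: measurable_coord.
Qed.

(** Within the n steps following time k, the path visits B, and avoids A up to
and including that visit.  Letting k vary makes the recursion on n a statement
about the same family of events. *)
Definition reach (k n : nat) : set (pathspace N) :=
  [set w | exists2 j, (j < n)%N &
     w (k + j).+1 \in B /\ forall i, (i <= j)%N -> w (k + i).+1 \notin A].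

Lemma reachS k n w : reach k n.+1 w <->
  w k.+1 \notin A /\ (w k.+1 \in B \/ reach k.+1 n w).
Proof.
split=> [[[|j] jn [wB wA]]|[wA [wB|[j jn [wB wA']]]]].
- by have := wA 0%N isT; rewrite addn0 in wB * => ?; split=> //; left.
- split; first by have := wA 0%N isT; rewrite addn0.
  right; exists j => //; rewrite addSnnS; split=> // i ij.
  by rewrite addSnnS; exact: wA.
- by exists 0%N; rewrite // addn0; split=> // -[|//] _; rewrite addn0.
- exists j.+1 => //; rewrite -addSnnS; split=> // -[|i] ij; first by rewrite addn0.
  by rewrite -addSnnS; exact: wA'.
Qed.

Lemma measurable_reach k n : measurable (reach k n).
Proof.
elim: n k => [k|n IH k].
  by rewrite (_ : reach k 0 = set0)//; apply/seteqP; split=> // w [].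
rewrite (_ : reach k n.+1 = [set w | [set y | y \notin A] (w k.+1)] `&`
    ([set w | [set y | y \in B] (w k.+1)] `|` reach k.+1 n)); last first.
  by apply/seteqP; split=> w /reachS.
apply: measurableI; first exact: measurable_coord.
by apply: measurableU => //; exact: measurable_coord.
Qed.

(** The value at y is that of going on from y: the outcome is settled on A and
on B, and is given by e elsewhere. *)
Definition boundary_values (e : config N -> R) y : R :=
  if y \in A then 0 else if y \in B then 1 else e y.

Fixpoint reach_prob (n : nat) s : R :=
  if n is n'.+1 then \sum_y q s y * boundary_values (reach_prob n') y else 0.

Lemma split_coord (P : probability (pathspace N) R) k (E : set (pathspace N)) :
  measurable E -> P E = (\sum_y P (E `&` [set w | w k = y]))%E.
Proof.
move=> mE.
have {1}-> : E = \bigcup_(y in [set: config N]) (E `&` [set w | w k = y]).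
  by apply/seteqP; split=> [w Ew|w [y _ []]//]; exists (w k).
rewrite measure_fin_bigcup//; last 2 first.
- by apply/trivIsetP => y z _ _ yz; apply/seteqP; split=> // w [[_ wy] [_ wz]];
    move: yz; rewrite -wy -wz eqxx.
- move=> y _; apply: measurableI => //; exact: (measurable_coord k [set y]).
rewrite (fsbigE (index_enum (config N))) ?index_enum_uniq//.
  by apply: eq_bigl => y; rewrite in_setT.
  by move=> y _; rewrite mem_index_enum.
exact: finite_finset.
Qed.

(** The Markov property at time k.  Keeping the whole past in a cylinder lets
the induction on n go through with the defining formula of the law alone:
splitting according to the state at time k + 1 turns the cylinder at time k into
a disjoint union of cylinders at time k + 1. *)
Lemma chain_law_cylinder_reach s k n (x : nat -> config N) :
  chain_law q s (cylinder k x `&` reach k n) =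
  ((x 0%N == s)%:R * \prod_(i < k) q (x i) (x i.+1) * reach_prob n (x k))%:E.
Proof.
elim: n k x => [k x|n IH k x].
  rewrite (_ : reach k 0 = set0) ?setI0 ?measure0 ?mulr0//.
  by apply/seteqP; split=> // w [].
rewrite (split_coord _ k.+1); last first.
  by apply: measurableI; [exact: measurable_cylinder|exact: measurable_reach].
rewrite /= mulr_sumr -sumEFin; apply: eq_bigr => y _.
(* the path x continued by the state y at time k + 1 *)
pose x' i := if (i == k.+1)%N then y else x i.
have x'k : x' k.+1 = y by rewrite /x' eqxx.
have x'E i : (i <= k)%N -> x' i = x i by move=> ik; rewrite /x' ltn_eqF.
have x'prod : (x' 0%N == s)%:R * \prod_(i < k.+1) q (x' i) (x' i.+1) =
    (x 0%N == s)%:R * \prod_(i < k) q (x i) (x i.+1) * q (x k) y.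
  rewrite big_ord_recr/= x'E// x'k x'E// -mulrA; congr (_ * (_ * _)).
  by apply: eq_bigr => i _; rewrite !x'E// ltnW.
have cylE : cylinder k x `&` [set w | w k.+1 = y] = cylinder k.+1 x'.
  apply/seteqP; split=> w /=.
    by move=> [cw wy] i; rewrite leq_eqVlt => /predU1P[->|]; rewrite ?x'k// => ik;
      rewrite x'E// cw.
  move=> cw; split; last by rewrite (cw k.+1)// x'k.
  by move=> i ik; rewrite (cw i (leqW ik)) x'E.
rewrite setIAC cylE mulrA -x'prod /boundary_values.
have [yA|yA] := boolP (y \in A).
  rewrite (_ : _ `&` _ = set0) ?measure0 ?mulr0//; apply/seteqP; split=> // w [cw].
  by move=> /reachS[]; rewrite (cw k.+1)// x'k yA.
have [yB|yB] := boolP (y \in B).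
  rewrite (_ : _ `&` _ = cylinder k.+1 x') ?chain_lawP ?mulr1//.
  apply/seteqP; split=> [w []//|w cw]; split=> //; apply/reachS.
  by rewrite (cw k.+1)// x'k yA yB; split=> //; left.
rewrite (_ : _ `&` _ = cylinder k.+1 x' `&` reach k.+1 n) ?IH ?x'k//.
apply/seteqP; split=> w [cw rw]; split=> //.
  by move/reachS : rw; rewrite (cw k.+1)// x'k (negbTE yB) => -[_ []].
by apply/reachS; rewrite (cw k.+1)// x'k yA; split=> //; right.
Qed.

Lemma chain_law_reach s n : chain_law q s (reach 0 n) = (reach_prob n s)%:E.
Proof.
rewrite (split_coord _ 0); last exact: measurable_reach.
have E y : chain_law q s (reach 0 n `&` [set w | w 0%N = y]) =
    ((y == s)%:R * reach_prob n y)%:E.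
  have := chain_law_cylinder_reach s 0 n (fun=> y).
  rewrite big_ord0 mulr1 => <-; congr (chain_law q s _).
  rewrite setIC; congr (_ `&` _); apply/seteqP; split=> w /=.
    by move=> w0 [|]//.
  by move=> cw; exact: (cw 0%N).
under eq_bigr do rewrite E.
rewrite (bigD1 s)//= eqxx mul1r big1 ?adde0// => y /negbTE ->.
by rewrite mul0r.
Qed.

(** As hitting times are infima over positive integers, a strict inequality
between them is witnessed at a finite time even when A is never visited. *)
Lemma hitting_time_lt_reach :
  [set w : pathspace N | (hitting_time (R := R) B w < hitting_time A w)%E] =
  \bigcup_n reach 0 n.
Proof.
apply/seteqP; split=> w /=.
  move=> /ereal_inf_lt[_ [t [t0 wB] <-]] tA; exists t => //.
  exists t.-1; rewrite ?prednK//; split=> [|i it]; first by rewrite ?add0n ?prednK.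
  apply/negP => wA; move: tA; rewrite ltNge => /negP; apply.
  apply: (@le_trans _ _ (i.+1%:R%:E)).
    by apply: ereal_inf_lbound; exists i.+1.
  by rewrite lee_fin ler_nat -(prednK t0).
move=> [n _ [j jn [wB wA]]].
apply: (@le_lt_trans _ _ (j.+1%:R%:E)).
  by apply: ereal_inf_lbound; exists j.+1.
apply: (@lt_le_trans _ _ (j.+2%:R%:E)); first by rewrite lte_fin ltr_nat.
apply: le_ereal_inf_tmp => _ [t [t0 tA] <-]; rewrite lee_fin ler_nat.
rewrite -(prednK t0) ltnS ltnNge; apply/negP => tj.
by have := wA t.-1 tj; rewrite add0n prednK// tA.
Qed.

Definition return_prob s : R := fine (chain_law q s
  [set w | (hitting_time (R := R) B w < hitting_time A w)%E]).

Lemma reach_prob_cvg s : reach_prob n s @[n --> \oo] --> return_prob s.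
Proof.
have fE : chain_law q s [set w | (hitting_time (R := R) B w < hitting_time A w)%E]
    = (return_prob s)%:E.
  rewrite fineK// hitting_time_lt_reach fin_num_measure//.
  by apply: bigcupT_measurable => n; exact: measurable_reach.
have : chain_law q s \o reach 0 @ \oo --> (return_prob s)%:E.
  rewrite -fE hitting_time_lt_reach; apply: nondecreasing_cvg_mu.
  - exact: measurable_reach.
  - by apply: bigcupT_measurable => n; exact: measurable_reach.
  - move=> m n mn; apply/subsetPset => w [j jm wj].
    by exists j => //; exact: leq_trans mn.
move=> /fine_cvg; rewrite (_ : fine \o _ = reach_prob ^~ s)//.
by apply/funext => n; rewrite /= chain_law_reach.
Qed.

(** Passing to the limit in the recursion of [reach_prob] avoids any discussion
of whether A or B is reached almost surely. *)
Lemma first_step s :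
  return_prob s = \sum_y q s y * boundary_values return_prob y.
Proof.
have : reach_prob n.+1 s @[n --> \oo] --> return_prob s.
  by move: (reach_prob_cvg (s := s)); rewrite -cvg_shiftS.
move/cvg_unique; apply => //=.
apply: cvg_big => [|y _]; first by exact: add_continuous. apply: cvgM; first exact: cvg_cst.
rewrite /boundary_values.
case: ifP => _; first exact: cvg_cst.
case: ifP => _; first exact: cvg_cst.
exact: reach_prob_cvg.
Qed.

End first_step.

(** * Dirichlet forms *)

Section dirichlet_form.
Context {R : realType} {T : finType}.
Variable c : T -> T -> R.
Hypotheses (c_sym : forall x y, c x y = c y x) (c_ge0 : forall x y, 0 <= c x y).
Implicit Types u v : T -> R.

Definition dirichlet u v : R :=
  2^-1 * \sum_x \sum_y c x y * ((u x - u y) * (v x - v y)).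

(** Discrete summation by parts: the symmetry of c lets x and y be exchanged, and
the average of the two expressions is the Dirichlet form. *)
Lemma green_identity u v :
  \sum_x u x * (\sum_y c x y * (v x - v y)) = dirichlet u v.
Proof.
set S := LHS.
have S1 : S = \sum_x \sum_y c x y * (u x * (v x - v y)).
  by apply: eq_bigr => x _; rewrite mulr_sumr; apply: eq_bigr => y _; ring.
have S2 : S = \sum_x \sum_y c x y * (u y * (v y - v x)).
  rewrite S1 exchange_big/=; apply: eq_bigr => x _; apply: eq_bigr => y _.
  by rewrite c_sym.
have SS : S + S = \sum_x \sum_y c x y * ((u x - u y) * (v x - v y)).
  rewrite {1}S1 S2 -big_split/=; apply: eq_bigr => x _.
  by rewrite -big_split/=; apply: eq_bigr => y _; ring.
by rewrite /dirichlet -SS; field.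
Qed.

(** This is nonnegativity of the form at u - v. *)
Lemma dirichlet_cross u v : dirichlet u v *+ 2 <= dirichlet u u + dirichlet v v.
Proof.
rewrite /dirichlet -mulrDr -mulrnAr ler_wpM2l ?invr_ge0// -sumrMnl -big_split/=.
apply: ler_sum => x _; rewrite -sumrMnl -big_split/=; apply: ler_sum => y _.
rewrite -mulrnAr -mulrDr ler_wpM2l//.
by have := sqr_ge0 ((u x - u y) - (v x - v y)); nra.
Qed.

End dirichlet_form.

(** * The capacity as a minimum of the Dirichlet form *)

Section capacity_variational.
Context {R : realType}.
Variables (N : nat) (beta : R) (H : config N -> R) (A B : {set config N}).
Hypothesis beta_ge0 : 0 <= beta.
Implicit Types (x y s : config N) (u v : config N -> R).

Definition conductance x y : R := expR (- beta * H x) * metropolis beta H x y.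

Lemma one_flip_sym x y : one_flip x y = one_flip y x.
Proof.
by rewrite /one_flip; congr (_ == _); apply: eq_card => i; rewrite !inE eq_sym.
Qed.

(** The Metropolis rule turns the weight of x times the rate into an expression
symmetric in x and y, which is detailed balance. *)
Lemma conductance_neq x y : x != y -> conductance x y =
  if one_flip x y then N%:R^-1 * expR (- beta * Num.max (H x) (H y)) else 0.
Proof.
move=> xy; rewrite /conductance /metropolis eq_sym (negbTE xy) /flip_rate.
case: ifP => _; last by rewrite mulr0.
rewrite mulrCA -expRD -mulrDr; congr (_ * expR (_ * _)).
by rewrite addrC; case: (leP (H x) (H y)) => hxy;
  [rewrite max_l ?subr_ge0// subrK|rewrite max_r ?add0r// subr_le0 ltW].
Qed.

Lemma conductance_sym x y : conductance x y = conductance y x.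
Proof.
have [->//|xy] := eqVneq x y.
by rewrite !conductance_neq// 1?eq_sym// one_flip_sym maxC.
Qed.

Lemma conductance_ge0 x y : 0 <= conductance x y.
Proof. by rewrite mulr_ge0 ?expR_ge0//; have [] := metropolis_stochastic H beta_ge0. Qed.

Lemma partition_function_gt0 : 0 < partition_function beta H.
Proof.
rewrite /partition_function (bigD1 (nseq_tuple N false : config N))//= ltr_pwDl ?expR_gt0//.
by apply: sumr_ge0 => s _; exact: expR_ge0.
Qed.

Definition equilibrium_potential x : R :=
  1 - boundary_values A B (return_prob (metropolis beta H) A B) x.

(** By [first_step], the generator applied to the potential vanishes off A and B,
and on A it is minus the probability of reaching B before returning to A.  A function u
equal to 1 on A and 0 on B therefore retains exactly the capacity. *)
Lemma capacity_dirichlet u :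
  {in A, forall x, u x = 1} -> {in B, forall x, u x = 0} ->
  partition_function beta H * capacity beta H A B =
  dirichlet conductance u equilibrium_potential.
Proof.
move=> uA uB; rewrite -green_identity//; last exact: conductance_sym.
rewrite /capacity mulr_sumr big_mkcond; apply: eq_bigr => x _.
set b := boundary_values A B (return_prob (metropolis beta H) A B).
have -> : \sum_y conductance x y * (equilibrium_potential x - equilibrium_potential y)
    = expR (- beta * H x) * (return_prob (metropolis beta H) A B x - b x).
  have [_ q1] := metropolis_stochastic H beta_ge0.
  rewrite first_step; last exact: metropolis_stochastic.
  rewrite -[b x]mul1r -(q1 x) mulr_suml -sumrB mulr_sumr.
  by apply: eq_bigr => y _; rewrite /conductance /equilibrium_potential -/b; ring.
rewrite /b /boundary_values; case: ifP => [xA|_].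
  rewrite uA// mul1r subr0 mulrA; congr (_ * _).
  by rewrite /gibbs mulrC divfK// gt_eqF// partition_function_gt0.
case: ifP => [xB|_]; first by rewrite uB// mul0r.
by rewrite subrr !mulr0.
Qed.

Hypothesis disjAB : [disjoint A & B]%B.

Lemma equilibrium_potentialA : {in A, forall x, equilibrium_potential x = 1}.
Proof. by move=> x xA; rewrite /equilibrium_potential /boundary_values xA subr0. Qed.

Lemma equilibrium_potentialB : {in B, forall x, equilibrium_potential x = 0}.
Proof.
move=> x xB; rewrite /equilibrium_potential /boundary_values xB.
by rewrite (disjointFl disjAB xB) subrr.
Qed.

Lemma capacity_equilibrium : partition_function beta H * capacity beta H A B =
  dirichlet conductance equilibrium_potential equilibrium_potential.
Proof. exact: capacity_dirichlet equilibrium_potentialA equilibrium_potentialB. Qed.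

(** The Dirichlet principle: [2 D(u, h) <= D(u, u) + D(h, h)], where both
[D(u, h)] and [D(h, h)] are the normalised capacity. *)
Lemma capacity_le_dirichlet u :
  {in A, forall x, u x = 1} -> {in B, forall x, u x = 0} ->
  partition_function beta H * capacity beta H A B <= dirichlet conductance u u.
Proof.
move=> uA uB; have := dirichlet_cross conductance_ge0 u equilibrium_potential.
by rewrite -capacity_equilibrium -capacity_dirichlet// mulr2n lerD2r.
Qed.

End capacity_variational.

(** * Bounding the form by a sum over single configurations *)

Section gradient_bounds.
Context {R : realType}.
Variables (N : nat) (beta : R) (H : config N -> R).
Hypothesis beta_ge0 : 0 <= beta.
Implicit Types (x y : config N) (u : config N -> R).

Definition sq_gradient u x : R :=
  N%:R^-1 * \sum_(y | one_flip x y) (u x - u y) ^+ 2.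

Lemma sq_increment_ge0 u x y : 0 <= N%:R^-1 * (u x - u y) ^+ 2.
Proof. by apply: mulr_ge0; [rewrite invr_ge0|exact: sqr_ge0]. Qed.

Lemma sq_gradient_ge0 u x : 0 <= sq_gradient u x.
Proof. by rewrite mulr_ge0 ?invr_ge0//; apply: sumr_ge0 => y _; exact: sqr_ge0. Qed.

Lemma dirichlet_conductanceE u :
  dirichlet (conductance beta H) u u = 2^-1 * \sum_x \sum_(y | one_flip x y)
    expR (- beta * Num.max (H x) (H y)) * (N%:R^-1 * (u x - u y) ^+ 2).
Proof.
congr (_ * _); apply: eq_bigr => x _; rewrite [RHS]big_mkcond/=.
apply: eq_bigr => y _; have [<-|xy] := eqVneq x y.
  by rewrite subrr expr0n/= !mulr0 if_same.
by rewrite conductance_neq//; case: ifP => _; [ring|rewrite mul0r].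
Qed.

(** Replacing the maximum of the two energies by the energy of one endpoint makes
each term depend on H at a single configuration, so that the couplings enter
through one exponential weight per configuration. *)
Lemma dirichlet_le_gradient u : dirichlet (conductance beta H) u u <=
  2^-1 * \sum_x expR (- beta * H x) * sq_gradient u x.
Proof.
rewrite dirichlet_conductanceE ler_wpM2l ?invr_ge0//; apply: ler_sum => x _.
rewrite /sq_gradient !mulr_sumr; apply: ler_sum => y _.
rewrite ler_wpM2r//; first exact: sq_increment_ge0.
by rewrite ler_expR !mulNr lerN2 ler_wpM2l// le_max lexx.
Qed.

Lemma dirichlet_ge_gradient u (d : R) :
  (forall x y, one_flip x y -> H y - H x <= d) -> 0 <= d ->
  expR (- beta * d) * (2^-1 * \sum_x expR (- beta * H x) * sq_gradient u x) <=
  dirichlet (conductance beta H) u u.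
Proof.
move=> Hd d0; rewrite dirichlet_conductanceE mulrCA ler_wpM2l ?invr_ge0//.
rewrite mulr_sumr; apply: ler_sum => x _.
rewrite /sq_gradient mulrA !mulr_sumr; apply: ler_sum => y xy.
rewrite ler_wpM2r//; first exact: sq_increment_ge0.
rewrite -expRD -mulrDr ler_expR !mulNr lerN2 ler_wpM2l// ge_max.
by have := Hd _ _ xy; lra.
Qed.

End gradient_bounds.

(** * Energies and couplings *)

Section energies.
Context {R : realType}.
Variable N : nat.
Implicit Types (x y : config N) (J : disorder N).

Lemma card_edge_le : (#|{: edge N}| <= N ^ 2)%N.
Proof.
rewrite card_sig; apply: leq_trans (max_card _) _.
by rewrite card_prod card_ord mulnn.
Qed.

Lemma spin_neq x y i : tnth x i != tnth y i -> spin y i = - spin x i :> R.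
Proof. by rewrite /spin; case: (tnth x i) (tnth y i) => [] [] //= _; rewrite opprK. Qed.

Lemma normr_spin x i : `|spin x i| = 1 :> R.
Proof. by rewrite /spin; case: ifP => _; rewrite ?normrN normr1. Qed.

Lemma spin_sq x i : spin x i ^+ 2 = 1 :> R.
Proof. by rewrite /spin; case: ifP => _; rewrite ?sqrrN expr1n. Qed.

(** Sending an edge at i to its other endpoint is injective. *)
Lemma card_edges_at (i : 'I_N) :
  (#|[pred e : edge N | ((val e).1 == i) || ((val e).2 == i)]| <= N)%N.
Proof.
pose other (e : edge N) := if (val e).1 == i then (val e).2 else (val e).1.
rewrite -[leqRHS](card_ord N) -(card_in_image (f := other)) ?max_card//.
move=> [[a b] ab] [[c d] cd]; rewrite !inE /other/= => h1 h2 h; apply: val_inj => /=.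
move: ab cd h1 h2 h => /=.
case: (eqVneq a i) => [->|ai]; case: (eqVneq c i) => [->|ci] /=.
- by move=> _ _ _ _ ->.
- by move=> ib ci' _ /eqP di bc; move: ib ci'; rewrite di bc; case: ltngtP.
- by move=> ai' id /eqP bi _ ad; move: id ai'; rewrite bi ad; case: ltngtP.
- by move=> _ _ /eqP -> /eqP -> ->.
Qed.

(** Only the pairs containing the flipped site matter, and each changes by at
most 2; there are at most N of them, which cancels the factor 1/N. *)
Lemma cw_energy_flip (h : R) x y : 0 <= h -> (0 < N)%N -> one_flip x y ->
  cw_energy h y - cw_energy h x <= 2 * (1 + h).
Proof.
move=> h0 N0 /cards1P[i xyi].
have flip j : spin y j = (if j == i then -1 else 1) * spin x j :> R.
  have := congr1 (fun A : {set 'I_N} => j \in A) xyi.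
  rewrite /= finset.in_set finset.in_set1; case: (eqVneq j i) => _.
    by move=> /spin_neq ->; rewrite mulN1r.
  by move=> /negbFE/eqP xy; rewrite mul1r /spin xy.
have N0' : 0 < N%:R :> R by rewrite ltr0n.
have field_part : \sum_j spin x j - \sum_j spin y j <= 2 :> R.
  rewrite -sumrB (bigD1 i)//= big1 ?addr0; last first.
    by move=> j /negbTE ji; rewrite flip ji mul1r subrr.
  by rewrite flip eqxx; have := ler_norm (spin x i : R); rewrite normr_spin; lra.
have pair_part : \sum_(e : edge N) spin x (val e).1 * spin x (val e).2 -
    \sum_(e : edge N) spin y (val e).1 * spin y (val e).2 <= 2 * N%:R :> R.
  rewrite -sumrB.
  rewrite (bigID [pred e : edge N | ((val e).1 == i) || ((val e).2 == i)])/=.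
  rewrite [X in _ + X]big1 ?addr0; last first.
    by move=> e; rewrite negb_or => /andP[/negbTE e1 /negbTE e2];
      rewrite !flip e1 e2; ring.
  apply: (@le_trans _ _ (\sum_(e : edge N | ((val e).1 == i) || ((val e).2 == i)) 2)).
    apply: ler_sum => e _; apply: (le_trans (ler_norm _)).
    by apply: (le_trans (ler_normB _ _)); rewrite !normrM !normr_spin; lra.
  rewrite sumr_const -[leLHS]mulr_natr ler_wpM2l// ler_nat; exact: card_edges_at.
have := ler_wpM2l h0 field_part.
have : N%:R^-1 * (\sum_(e : edge N) spin x (val e).1 * spin x (val e).2 -
    \sum_(e : edge N) spin y (val e).1 * spin y (val e).2) <= 2 :> R.
  by rewrite ler_pdivrMl// mulrC.
by rewrite /cw_energy; lra.
Qed.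

(** The coefficient of the centred coupling at e in minus beta times the
difference of the dilute and Curie-Weiss energies of x. *)
Definition tilt (p beta : R) x (e : edge N) : R :=
  beta / (N%:R * p) * (spin x (val e).1 * spin x (val e).2).

Lemma tilt_sq p beta x e : tilt p beta x e ^+ 2 = (beta / (N%:R * p)) ^+ 2.
Proof. by rewrite /tilt !exprMn !spin_sq !mulr1. Qed.

Lemma rdcw_weightE (p h beta : R) J x : 0 < p -> (0 < N)%N ->
  expR (- beta * rdcw_energy p h J x) = expR (- beta * cw_energy h x) *
    expR (\sum_e tilt p beta x e * ((J e)%:R - p)).
Proof.
move=> p0 N0; rewrite -expRD; congr expR.
have N0' : N%:R != 0 :> R by rewrite pnatr_eq0 -lt0n.
have -> : \sum_e tilt p beta x e * ((J e)%:R - p) = beta / (N%:R * p) *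
    (\sum_(e : edge N) (J e)%:R * spin x (val e).1 * spin x (val e).2) -
    beta / N%:R * (\sum_(e : edge N) spin x (val e).1 * spin x (val e).2).
  rewrite !mulr_sumr -sumrB; apply: eq_bigr => e _; rewrite /tilt.
  by field; rewrite N0' gt_eqF.
by rewrite /rdcw_energy /cw_energy; field; rewrite N0' gt_eqF.
Qed.

End energies.

(** * Exponential moments of the couplings *)

Section moments.
Context {R : realType}.

(** The linear term x disappears for a centred variable, which leaves a
sub-Gaussian bound.  For x < 1/2 it follows from [exp x <= 1 / (1 - x)]; for larger
x the quadratic exponent already dominates. *)
Lemma expR_le_quadratic (x : R) : expR x <= x + expR (2 * x ^+ 2).
Proof.
have [x2|x2] := leP (2^-1) x.
  have : expR x <= expR (2 * x ^+ 2) by rewrite ler_expR; nra.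
  by lra.
have x1 : 0 < 1 - x by lra.
have : expR x <= (1 - x)^-1.
  rewrite -[x]opprK expRN opprK lef_pV2 ?posrE ?expR_gt0//.
  by have := expR_ge1Dx (- x); lra.
have : (1 - x)^-1 <= 1 + x + 2 * x ^+ 2.
  by rewrite -[leLHS]mul1r ler_pdivrMr//; nra.
by have := expR_ge1Dx (2 * x ^+ 2); lra.
Qed.

Lemma bernoulli_mgf (p a : R) : 0 < p -> p < 1 ->
  \sum_(b : bool) bernoulli_pmf p b * expR (a * (b%:R - p)) <= expR (2 * a ^+ 2).
Proof.
move=> p0 p1; rewrite big_bool /= /bernoulli_pmf.
set u := a * (true%:R - p); set v := a * (false%:R - p).
have uE : expR u <= u + expR (2 * a ^+ 2).
  apply: le_trans (expR_le_quadratic u) _; rewrite lerD2l ler_expR /u/=.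
  rewrite ler_wpM2l// exprMn ler_piMr ?sqr_ge0//.
  by rewrite expr_le1//; lra.
have vE : expR v <= v + expR (2 * a ^+ 2).
  apply: le_trans (expR_le_quadratic v) _; rewrite lerD2l ler_expR /v/=.
  rewrite ler_wpM2l// exprMn ler_piMr ?sqr_ge0// sub0r sqrrN.
  by rewrite expr_le1//; lra.
have := ler_wpM2l (ltW p0) uE.
have q0 : 0 <= 1 - p by lra.
have := ler_wpM2l q0 vE.
have : p * u + (1 - p) * v = 0 by rewrite /u /v/=; ring.
by nra.
Qed.

(** The couplings are independent, so the expectation factors over the edges. *)
Lemma disorder_mgf N (p c : R) (a : edge N -> R) : 0 < p -> p < 1 ->
  (forall e, a e ^+ 2 = c) -> 0 <= c ->
  \sum_(J : disorder N) (\prod_e bernoulli_pmf p (J e)) *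
    expR (\sum_e a e * ((J e)%:R - p)) <= expR (2 * N%:R ^+ 2 * c).
Proof.
move=> p0 p1 ac c0.
under eq_bigr do rewrite expR_sum -big_split/=.
rewrite -(bigA_distr_bigA (fun e b => bernoulli_pmf p b * expR (a e * (b%:R - p))))/=.
apply: (@le_trans _ _ (\prod_(e : edge N) expR (2 * c))).
  apply: ler_prod => e _; apply/andP; split; last by rewrite -(ac e) bernoulli_mgf.
  by apply: sumr_ge0 => b _; rewrite mulr_ge0 ?expR_ge0// bernoulli_pmf_ge0// !ltW.
rewrite prodr_const -expRM_natl ler_expR mulrCA -mulrA ler_wpM2l//.
by rewrite ler_wpM2r// -natrX ler_nat card_edge_le.
Qed.

Lemma bernoulli_ineq (z : R) k : -1 <= z -> 1 + z *+ k <= (1 + z) ^+ k.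
Proof.
move=> z1; elim: k => [|k IH]; first by rewrite mulr0n addr0 expr0.
have z0 : 0 <= 1 + z by lra.
rewrite exprS; apply: le_trans (ler_wpM2l z0 IH).
rewrite -[z *+ k.+1]mulr_natr -[z *+ k]mulr_natr -natr1; have : 0 <= k%:R :> R by [].
by nra.
Qed.

(** Convexity of the k-th power, used through its tangent at 1: the tangent's
w-average at X / c is at least the total weight as soon as the mean of X is at
least c. *)
Lemma weighted_power_ge (T : finType) (w X : T -> R) c k :
  (forall x, 0 <= w x) -> (forall x, 0 <= X x) -> 0 < c ->
  c * \sum_x w x <= \sum_x w x * X x ->
  \sum_x w x <= \sum_x w x * (X x / c) ^+ k.
Proof.
move=> w0 X0 c0 cw.
apply: (@le_trans _ _ (\sum_x w x * (1 + (X x / c - 1) *+ k))); last first.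
  apply: ler_sum => x _; rewrite ler_wpM2l//.
  apply: le_trans (bernoulli_ineq _ _) _; last by rewrite addrCA subrr addr0.
  by have : 0 <= X x / c; [rewrite divr_ge0// ltW|lra].
rewrite -subr_ge0 -sumrB.
have -> : \sum_x (w x * (1 + (X x / c - 1) *+ k) - w x) =
    (c^-1 * (\sum_x w x * X x - c * \sum_x w x)) *+ k.
  rewrite mulr_sumr -sumrB mulr_sumr -sumrMnl; apply: eq_bigr => x _.
  rewrite -[_ *+ k]mulr_natr -[RHS]mulr_natr; field; by rewrite gt_eqF.
by apply: mulrn_wge0; apply: mulr_ge0; rewrite ?invr_ge0 ?subr_ge0// ltW.
Qed.

(** Markov's inequality for the w-average of k-th powers, instead of the k-th
power of the w-average: the expectation can then be taken term by term, and no
correlation between different x matters. *)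
Lemma prob_J_weighted_tail N (T : finType) (p c s : R) (w : T -> R)
    (a : T -> edge N -> R) k :
  0 < p -> p < 1 -> (forall x, 0 <= w x) ->
  (forall x e, a x e ^+ 2 = c) -> 0 <= c ->
  prob_J p (fun J : disorder N => expR s * \sum_x w x <
     \sum_x w x * expR (\sum_e a x e * ((J e)%:R - p))) <=
  expR (2 * N%:R ^+ 2 * c * k%:R ^+ 2 - k%:R * s).
Proof.
move=> p0 p1 w0 ac c0.
pose P (J : disorder N) := \prod_e bernoulli_pmf p (J e).
have P0 J : 0 <= P J.
  by apply: prodr_ge0 => e _; rewrite bernoulli_pmf_ge0// !ltW.
pose X x (J : disorder N) := expR (\sum_e a x e * ((J e)%:R - p)).
have := sumr_ge0 (index_enum T) (P := predT) (F := w) (fun x _ => w0 x).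
rewrite le_eqVlt => /predU1P[W0|W0].
  (* if all the weights vanish, the event is empty *)
  rewrite [leLHS](_ : _ = 0) ?expR_ge0// /prob_J big_pred0// => J.
  rewrite -W0 mulr0; apply/negbTE; rewrite -leNgt le_eqVlt big1 ?eqxx// => x _.
  by have /psumr_eq0P -> := esym W0; rewrite ?mul0r.
rewrite -(ler_pM2r W0).
apply: (@le_trans _ _ (\sum_J P J * \sum_x w x * (X x J / expR s) ^+ k)).
  rewrite /prob_J mulr_suml big_mkcond/=; apply: ler_sum => J _.
  have wX0 : 0 <= \sum_x w x * (X x J / expR s) ^+ k.
    by apply: sumr_ge0 => x _; rewrite mulr_ge0// exprn_ge0// divr_ge0 ?expR_ge0.
  case: ifP => [/ltW J1|_]; last by rewrite mulr_ge0.
  rewrite ler_wpM2l// ?P0//; apply: weighted_power_ge => //; first by move=> x; exact: expR_ge0.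
  exact: expR_gt0.
under eq_bigr do rewrite mulr_sumr.
rewrite exchange_big/= mulr_sumr; apply: ler_sum => x _.
have -> : \sum_J P J * (w x * (X x J / expR s) ^+ k) = w x * expR (- (k%:R * s)) *
    \sum_J P J * expR (\sum_e (k%:R * a x e) * ((J e)%:R - p)).
  rewrite mulr_sumr; apply: eq_bigr => J _.
  have -> : (X x J / expR s) ^+ k = expR (- (k%:R * s)) *
      expR (\sum_e (k%:R * a x e) * ((J e)%:R - p)).
    rewrite -expRN -!expRD -expRM_natl; congr expR.
    rewrite mulrDr mulrN addrC mulr_sumr; congr (_ + _).
    by apply: eq_bigr => e _; rewrite mulrA.
  by ring.
rewrite -mulrA [leRHS]mulrC ler_wpM2l// [leLHS]mulrC expRD ler_wpM2r ?expR_ge0//.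
rewrite (_ : 2 * N%:R ^+ 2 * c * k%:R ^+ 2 = 2 * N%:R ^+ 2 * (c * k%:R ^+ 2)); last by ring.
apply: disorder_mgf => //; last by rewrite mulr_ge0 ?sqr_ge0.
by move=> e; rewrite exprMn ac mulrC.
Qed.

(** The real minimiser of [C k^2 - k s] is [s / (2 C)].  Its integer part loses
only a bounded amount and half of the Gaussian rate; it may be 0, in which case
the right-hand side is nonnegative. *)
Lemma exists_tail_exponent (C s : R) : 0 < C -> 0 < s ->
  exists k : nat, C * k%:R ^+ 2 - k%:R * s <= C / 2 - (8 * C)^-1 * s ^+ 2.
Proof.
move=> C0 s0; pose t := s / (2 * C).
have t0 : 0 <= t by rewrite divr_ge0 ?mulr_ge0// ltW.
have sE : s = 2 * C * t by rewrite /t; field; rewrite gt_eqF.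
exists (Num.truncn t); have /andP[] := truncn_itv t0; rewrite -natr1.
set k : R := (Num.truncn t)%:R => kt tk.
have k0 : 0 <= k by rewrite /k.
have -> : C / 2 - (8 * C)^-1 * s ^+ 2 = C * (2^-1 - 2^-1 * t ^+ 2).
  by rewrite sE; field; rewrite gt_eqF.
have -> : C * k ^+ 2 - k * s = C * (k ^+ 2 - 2 * k * t) by rewrite sE; ring.
by rewrite ler_wpM2l ?ltW//; nra.
Qed.

Lemma prob_J_compl N (p : R) (E : pred (disorder N)) :
  prob_J p E = 1 - prob_J p (fun J => ~~ E J).
Proof.
apply/eqP; rewrite eq_sym subr_eq; apply/eqP; rewrite /prob_J -(bigID E predT)/=.
rewrite -(bigA_distr_bigA (fun (e : edge N) b => bernoulli_pmf p b))/= big1// => e _.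
by rewrite big_bool/= /bernoulli_pmf addrC subrK.
Qed.

Lemma prob_J_mono N (p : R) (E F : pred (disorder N)) : 0 < p -> p < 1 ->
  (forall J, E J -> F J) -> prob_J p E <= prob_J p F.
Proof.
move=> p0 p1 EF; rewrite /prob_J [leLHS]big_mkcond [leRHS]big_mkcond/=.
apply: ler_sum => J _; have := EF J; case: (E J) => [->//|_].
by case: ifP => // _; apply: prodr_ge0 => e _; rewrite bernoulli_pmf_ge0// !ltW.
Qed.

End moments.

(** * Comparison of the two capacities *)

Lemma disjoint_level (R : realType) N (m1 m2 : R) : m1 <> m2 ->
  [disjoint level N m1 & level N m2]%B.
Proof.
move=> m12; apply/pred0P => x; rewrite /= !finset.in_set.
by apply/negbTE/negP => /andP[/eqP -> /eqP].
Qed.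

(** The Curie-Weiss potential f is a good test function for the dilute chain
because both forms are comparable to sums of [|grad f|^2] with the respective
Boltzmann weights. *)
Lemma capacity_ratio_tail (R : realType) N (p beta h s : R)
    (A B : {set config N}) k :
  0 < p -> p < 1 -> 0 < beta -> 0 < h -> (0 < N)%N ->
  [disjoint A & B]%B ->
  prob_J p (fun J : disorder N => expR (s + 2 * beta * (1 + h)) <
    (partition_function beta (rdcw_energy p h J) *
       capacity beta (rdcw_energy p h J) A B) /
    (partition_function beta (cw_energy (N := N) h) *
       capacity beta (cw_energy (N := N) h) A B)) <=
  expR (2 * beta ^+ 2 / p ^+ 2 * k%:R ^+ 2 - k%:R * s).
Proof.
move=> p0 p1 b0 h0 N0 AB; have b0' := ltW b0.
set Hcw := cw_energy (N := N) h.
pose f := equilibrium_potential beta Hcw A B.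
have fA : {in A, forall x, f x = 1} := equilibrium_potentialA beta Hcw B.
have fB : {in B, forall x, f x = 0} := equilibrium_potentialB beta Hcw AB.
pose w x := expR (- beta * Hcw x) * sq_gradient f x.
have w0 x : 0 <= w x by rewrite mulr_ge0 ?expR_ge0 ?sq_gradient_ge0.
have N0' : N%:R != 0 :> R by rewrite pnatr_eq0 -lt0n.
have -> : 2 * beta ^+ 2 / p ^+ 2 = 2 * N%:R ^+ 2 * (beta / (N%:R * p)) ^+ 2.
  by field; rewrite N0' gt_eqF.
apply: le_trans (prob_J_weighted_tail s k p0 p1 w0 (tilt_sq p beta) (sqr_ge0 _)).
apply: prob_J_mono => // J.
set D := _ * capacity _ Hcw _ _; set D' := _ * capacity _ _ _ _ => DD'.
have D_ge0 : 0 <= D.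
  rewrite /D capacity_equilibrium//.
  rewrite mulr_ge0 ?invr_ge0//; do 2 (apply: sumr_ge0 => ? _).
  by rewrite mulr_ge0 ?conductance_ge0// -expr2 sqr_ge0.
(* a division by zero gives 0, which is below the threshold *)
have D_gt0 : 0 < D.
  rewrite lt_neqAle D_ge0 andbT; apply/eqP => D0.
  by move: DD'; rewrite -D0 invr0 mulr0 ltNge expR_ge0.
have D'_le : D' <= 2^-1 * \sum_x w x * expR (\sum_e tilt p beta x e * ((J e)%:R - p)).
  apply: (le_trans (capacity_le_dirichlet _ b0' AB fA fB)).
  apply: (le_trans (dirichlet_le_gradient _ b0' f)).
  rewrite ler_wpM2l ?invr_ge0// le_eqVlt; apply/orP; left; apply/eqP.
  by apply: eq_bigr => x _; rewrite rdcw_weightE// mulrAC.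
have D_ge : expR (- beta * (2 * (1 + h))) * (2^-1 * \sum_x w x) <= D.
  rewrite /D capacity_equilibrium//; apply: dirichlet_ge_gradient => //.
    by move=> x y xy; apply: cw_energy_flip => //; exact: ltW.
  by lra.
rewrite ltr_pdivlMr// in DD'.
have := lt_le_trans (le_lt_trans (ler_wpM2l (expR_ge0 _) D_ge) DD') D'_le.
rewrite mulrA -expRD (_ : s + _ + _ = s); last by ring.
by rewrite mulrCA ltr_pM2l// invr_gt0.
Qed.

Theorem theorem1p4 (R : realType) (p beta : R)
    (p_gt0 : 0 < p) (p_lt1 : p < 1) (beta_gt0 : 0 < beta) :
  exists k1 k2 : R, [/\ 0 < k1, 0 < k2 &
    forall (h s : R), 0 < h -> 0 < s ->
    exists o1 : nat -> R, (o1 @ \oo --> 0) /\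
      \forall N \near \oo, forall m1 m2 : R,
        Gamma N m1 -> Gamma N m2 -> m1 <> m2 ->
        1 - k1 * expR (- k2 * s ^+ 2) <=
        prob_J p (fun J : disorder N =>
          (partition_function beta (rdcw_energy p h J) *
             capacity beta (rdcw_energy p h J) (level N m1) (level N m2)) /
          (partition_function beta (cw_energy (N := N) h) *
             capacity beta (cw_energy (N := N) h) (level N m1) (level N m2))
          <= expR (s + 2 * beta * (1 + h) + beta ^+ 2 * (1 - p) / (4 * p)) *
             (1 + o1 N))].
Proof.
pose C := 2 * beta ^+ 2 / p ^+ 2.
have C0 : 0 < C by rewrite divr_gt0 ?mulr_gt0 ?exprn_gt0.
exists (expR (C / 2)), (8 * C)^-1; split; first exact: expR_gt0.
  by rewrite invr_gt0 mulr_gt0.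
move=> h s h0 s0; exists (fun=> 0); split; first exact: cvg_cst.
exists 1%N => // N /= N0 m1 m2 _ _ m12.
rewrite prob_J_compl lerD2l lerN2.
have [k Ck] := exists_tail_exponent C0 s0.
apply: (@le_trans _ _ (expR (C * k%:R ^+ 2 - k%:R * s))); last first.
  by rewrite -expRD ler_expR mulNr.
apply: le_trans (capacity_ratio_tail s k p_gt0 p_lt1 beta_gt0 h0 N0
  (disjoint_level N m12)).
(* dropping exp alpha >= 1 only enlarges the event *)
apply: prob_J_mono => // J; rewrite -ltNge addr0 mulr1; apply: le_lt_trans.
rewrite ler_expR lerDl divr_ge0 ?mulr_ge0 ?sqr_ge0//; lra.
Qed.
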